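(* Let $\mathfrak{C}=\{C_j \mid 0\le j\le n\}$ be a coin operator system on $\mathcal{K}$ and, for each magnetic potential $\nu$ on $\Gamma_n$, let $\mathsf{W}^{(\nu)}=\sum_{j=0}^n \Xi_j^{(\nu)}\otimes C_j$ on $\mathfrak{h}_n\otimes\mathcal{K}$. Then both the point-spectrum $\mathrm{Spec}^{(p)}(\mathsf{W}^{(\nu)})$ and the approximate-spectrum $\mathrm{Aev}(\mathsf{W}^{(\nu)})$ are independent of the magnetic potential $\nu$; that is, for any two magnetic potentials $\nu,\nu'$ on $\Gamma_n$, $$\mathrm{Spec}^{(p)}(\mathsf{W}^{(\nu)})=\mathrm{Spec}^{(p)}(\mathsf{W}^{(\nu')})\quad\text{and}\quad \mathrm{Aev}(\mathsf{W}^{(\nu)})=\mathrm{Aev}(\mathsf{W}^{(\nu')}).$$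
   Context: Fix an integer $n\ge 0$. $\mathbb{N}_n=\{0,1,\dots,n\}$ and $\Gamma_n$ is the power set of $\mathbb{N}_n$. $\mathfrak{h}_n$ is the complex Hilbert space of dimension $2^{n+1}$ with orthonormal basis $\{Z_\sigma\mid\sigma\in\Gamma_n\}$. For $j\in\mathbb{N}_n$, the operators $\partial_j$ and $\partial_j^*$ on $\mathfrak{h}_n$ are the (mutually adjoint) linear operators determined by $\partial_jZ_\sigma=\mathbf{1}_\sigma(j)Z_{\sigma\setminus\{j\}}$ and $\partial_j^*Z_\sigma=(1-\mathbf{1}_\sigma(j))Z_{\sigma\cup\{j\}}$, where $\mathbf{1}_\sigma$ is the indicator function of $\sigma$. A magnetic potential on $\Gamma_n$ is a function $\nu:\Gamma_n\times\Gamma_n\to[-\pi,\pi]$ with $\nu(\sigma,\tau)=-\nu(\tau,\sigma)$ for all $\sigma,\tau\in\Gamma_n$. Put $\nu_j=\nu(\{j\},\mathbb{N}_n\setminus\{j\})$ for $j\in\mathbb{N}_n$, and $\Xi_j^{(\nu)}=e^{-\mathrm{i}\nu_j}\partial_j^*+e^{\mathrm{i}\nu_j}\partial_j$, an operator on $\mathfrak{h}_n$. $\mathcal{K}$ is a complex separable Hilbert space (possibly infinite-dimensional) with $\dim\mathcal{K}\ge n+1$. A coin operator system on $\mathcal{K}$ is a family $\{C_j\mid 0\le j\le n\}$ of bounded linear operators on $\mathcal{K}$ such that $\sum_{j=0}^nC_j$ is unitary and $C_j^*C_k=C_jC_k^*=0$ for all $j\ne k$, $0\le j,k\le n$. $\mathrm{Spec}^{(p)}(T)$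 denotes the set of all eigenvalues of an operator $T$. For a bounded operator $T$ on a complex Hilbert space $\mathcal{H}$, a complex number $\lambda$ is an approximate eigenvalue of $T$ if there is a sequence $(x_k)_{k\ge1}$ of unit vectors in $\mathcal{H}$ with $\|Tx_k-\lambda x_k\|\to0$ as $k\to\infty$; $\mathrm{Aev}(T)$ is the set of all approximate eigenvalues of $T$. *)

(* Defs.v *)
From HB Require Import structures.
From mathcomp Require Import all_boot all_order all_algebra.
From mathcomp Require Import complex.
From mathcomp Require Import boolp classical_sets functions cardinality reals.
From mathcomp Require Import topology normedtype sequences trigo.
Set Implicit Arguments.
Unset Strict Implicit.
Unset Printing Implicit Defensive.
Import Order.TTheory GRing.Theory Num.Theory.
Import numFieldNormedType.Exports.
Local Open Scope classical_set_scope.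
Local Open Scope complex_scope.
Local Open Scope ring_scope.

(* Inner products are linear in the first argument and conjugate-linear in the
   second, as for the library's [{dot U for Num.conj}]. *)

HB.mixin Record isHilbert (C : numClosedFieldType) H of CompleteNormedModule C H := {
  inner : {dot H for (@Num.conj C)};
  sqr_norm_inner : forall x : H, `|x| ^+ 2 = inner x x
}.

#[short(type="hilbertType")]
HB.structure Definition Hilbert (C : numClosedFieldType) :=
  {H of isHilbert C H & CompleteNormedModule C H}.

Section dot_triangle.
Variables (C : numClosedFieldType) (U : lmodType C) (dp : {dot U for (@Num.conj C)}).

Lemma dot_CauchySchwarz (u v : U) : `|dp u v| ^+ 2 <= dp u u * dp v v.
Proof.
have [->|v0] := eqVneq v 0.
  by rewrite linear0r normr0 expr0n/= mulr_ge0 ?dnorm_ge0.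
have v_gt0 : 0 < dp v v by exact: neq0_dnorm_gt0.
set a := dp u v / dp v v.
have uvE : dp u v = a * dp v v by rewrite divfK ?gt_eqF.
have ov : dp (u - a *: v) v = 0.
  by rewrite linearBl/= linearZl_LR/= -uvE subrr.
have E : dp u u = dp (u - a *: v) (u - a *: v) + `|a| ^+ 2 * dp v v.
  rewrite -[in LHS](subrK (a *: v) u) hnormD/= dnormZ.
  by rewrite linearZr_LR/= ov mulr0 rmorph0 mulr0 !addr0.
rewrite uvE normrM exprMn (gtr0_norm v_gt0) E mulrDl expr2 mulrA.
by rewrite lerDr mulr_ge0 ?dnorm_ge0.
Qed.

Lemma dot_triangle (u v : U) :
  sqrtC (dp (u + v) (u + v)) <= sqrtC (dp u u) + sqrtC (dp v v).
Proof.
rewrite -ler_sqr ?nnegrE ?addr_ge0 ?sqrtC_ge0 ?dnorm_ge0//.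
rewrite sqrrD !sqrtCK hnormD/= expr0 mul1r addrAC lerD2r lerD2l.
have -> : dp u v + (dp u v)^* = 'Re (dp u v) *+ 2.
  by rewrite ReE -mulr_natr divfK ?pnatr_eq0.
rewrite lerMn2r/= (le_trans (leif_Re_Creal _).1)//.
rewrite -sqrtCM ?nnegrE ?dnorm_ge0// -[leLHS]sqrCK ?normr_ge0//.
by rewrite ler_sqrtC ?nnegrE ?exprn_ge0 ?mulr_ge0 ?dnorm_ge0 ?dot_CauchySchwarz.
Qed.

End dot_triangle.

(* [{ffun I -> H}] is the Hilbert sum of [#|I|] copies of [H]. *)
Section ffun_hilbert.
Variables (C : numClosedFieldType) (I : finType) (H : hilbertType C).
Local Notation T := {ffun I -> H}.

Definition ffun_inner (f g : T) : C := \sum_(i : I) inner (f i) (g i).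

Lemma ffun_inner_bilinear : bilinear_for
  (GRing.Scale.Law.clone _ _ *%R _)
  (GRing.Scale.Law.clone _ _ (@Num.conj C \; *%R) _) ffun_inner.
Proof.
split=> [g|f] a x y /=; rewrite /ffun_inner mulr_sumr -big_split/=.
  by apply: eq_bigr => i _; rewrite !ffunE linearDl/= linearZl_LR.
by apply: eq_bigr => i _; rewrite !ffunE linearDr/= linearZr_LR.
Qed.
HB.instance Definition _ := @bilinear_isBilinear.Build _ _ _ _ _ _ ffun_inner
  ffun_inner_bilinear.

Lemma ffun_inner_herm (f g : T) :
  ffun_inner f g = (-1) ^+ false * Num.conj (ffun_inner g f).
Proof.
rewrite expr0 mul1r rmorph_sum; apply: eq_bigr => i _.
by rewrite [LHS]hermC/= expr0 mul1r.
Qed.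
HB.instance Definition _ := @isHermitianSesquilinear.Build _ _ _ _ ffun_inner
  ffun_inner_herm.

Lemma ffun_inner_gt0 (f : T) : f != 0 -> 0 < ffun_inner f f.
Proof.
move=> f0; have [i fi0] : exists i, f i != 0.
  apply/existsP; apply: contraNT f0; rewrite negb_exists => /forallP f0.
  by apply/eqP/ffunP => i; rewrite ffunE; apply/eqP; rewrite -[_ == _]negbK f0.
rewrite /ffun_inner (bigD1 i)//= ltr_pwDl ?neq0_dnorm_gt0//.
by rewrite sumr_ge0// => j _; exact: dnorm_ge0.
Qed.
HB.instance Definition _ := @isDotProduct.Build _ _ ffun_inner ffun_inner_gt0.

Definition ffun_norm (f : T) : C := sqrtC (ffun_inner f f).

Lemma ffun_normD (f g : T) : ffun_norm (f + g) <= ffun_norm f + ffun_norm g.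
Proof. exact: dot_triangle. Qed.

Lemma ffun_normZ (l : C) (f : T) : ffun_norm (l *: f) = `|l| * ffun_norm f.
Proof.
rewrite /ffun_norm dnormZ sqrtCM ?nnegrE ?exprn_ge0 ?dnorm_ge0//.
by rewrite sqrCK.
Qed.

Lemma ffun_norm0_eq0 (f : T) : ffun_norm f = 0 -> f = 0.
Proof. by move/eqP; rewrite sqrt_dnorm_eq0 => /eqP. Qed.

HB.instance Definition _ := @Lmodule_isNormed.Build C T ffun_norm
  ffun_normD ffun_normZ ffun_norm0_eq0.

Lemma ffun_normE (f : T) : `|f| = sqrtC (\sum_i `|f i| ^+ 2).
Proof.
by congr sqrtC; apply: eq_bigr => i _; rewrite sqr_norm_inner.
Qed.

Let sqr_ge0 (P : pred I) (f : T) : 0 <= \sum_(i | P i) `|f i| ^+ 2.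
Proof. by apply: sumr_ge0 => i _; exact: exprn_ge0. Qed.

Lemma ffun_norm_ge (f : T) i : `|f i| <= `|f|.
Proof.
rewrite ffun_normE -[leLHS]sqrCK// ler_sqrtC ?nnegrE ?exprn_ge0//.
by rewrite (bigD1 i)//= lerDl.
Qed.

Lemma ffun_norm_le (f : T) : `|f| <= \sum_i `|f i|.
Proof.
rewrite ffun_normE -ler_sqr ?nnegrE ?sqrtC_ge0 ?sqr_ge0 ?sumr_ge0// sqrtCK.
rewrite [leRHS]expr2 mulr_suml; apply: ler_sum => i _.
by rewrite expr2 ler_wpM2l// (bigD1 i)//= lerDl sumr_ge0.
Qed.

Lemma ffun_complete (F : set_system T) : ProperFilter F -> cauchy F -> cvg F.
Proof.
move=> FF /cauchy_ballP Fc.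
have Fi i : cvg ((fun f : T => f i) @ F).
  apply: cauchy_cvg; apply/cauchy_ballP => e e0; rewrite near_map2.
  apply: filterS (Fc e e0) => -[f g]/=; rewrite -!ball_normE/=.
  apply: le_lt_trans; have -> : f i - g i = (f - g) i by rewrite !ffunE.
  exact: (ffun_norm_ge (f - g) i).
apply/cvg_ex; exists [ffun i => lim ((fun f : T => f i) @ F)].
apply/cvgrPdist_lt => e e0; pose d : C := e / #|I|.+1%:R.
have d0 : 0 < d by rewrite divr_gt0.
have : \forall f \near F, forall i, `|lim ((fun f : T => f i) @ F) - (f : T) i| < d.
  by apply: filter_forall => i; apply: (cvgrPdist_lt _ _).1 d0; exact: Fi.
apply: filterS => f fd; apply: le_lt_trans (ffun_norm_le _) _.
apply: (@le_lt_trans _ _ (\sum_(i : I) d)).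
  by apply: ler_sum => i _; rewrite !ffunE ltW.
by rewrite sumr_const -mulr_natr /d -mulrA gtr_pMr// mulrC ltr_pdivrMr// mul1r ltr_nat.
Qed.
HB.instance Definition _ := @Uniform_isComplete.Build T ffun_complete.
HB.instance Definition _ := @isHilbert.Build C T ffun_inner
  (fun f => sqrtCK _).
End ffun_hilbert.

Section operators.
Variables (C : numClosedFieldType) (H : hilbertType C).

(* In [C], [a <= b] forces [b - a] to be real, so [M] may be taken real. *)
Definition bounded_op (T : H -> H) := exists M : C, forall x, `|T x| <= M * `|x|.

Definition is_adjoint (T S : H -> H) := forall x y, inner (T x) y = inner x (S y).

Definition unitary (U : H -> H) :=
  exists V : H -> H, [/\ is_adjoint U V, cancel U V & cancel V U].

Definition separable := exists A : set H, countable A /\ dense A.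

(* Hilbert dimension at least [m], witnessed by an orthonormal family. *)
Definition dim_ge (m : nat) :=
  exists e : 'I_m -> H, forall i j, inner (e i) (e j) = (i == j)%:R.

Definition point_spectrum (T : H -> H) : set C :=
  [set l | exists2 x : H, x != 0 & T x = l *: x].

Definition approximate_spectrum (T : H -> H) : set C :=
  [set l | exists x : nat -> H, (forall k, `|x k| = 1) /\
     (fun k => `|T (x k) - l *: x k|) @ \oo --> (0 : C)].

(* The adjoints [D j] are unique, and exist for bounded [c j] by the Riesz
   representation theorem. *)
Definition coin_system (n : nat) (c : 'I_n.+1 -> {linear H -> H}) :=
  [/\ forall j, bounded_op (c j),
      unitary (fun x => \sum_j c j x) &
      exists2 D : 'I_n.+1 -> H -> H, (forall j, is_adjoint (c j) (D j)) &
        forall j k, j != k ->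
          (forall x, D j (c k x) = 0) /\ (forall x, c j (D k x) = 0)].

End operators.
Arguments separable {C} H.
Arguments dim_ge {C} H m.

(* [h_n], as functions on the power set of [{0, ..., n}]. *)
Notation hspace C n := {ffun {set 'I_(n.+1)} -> C^o}.

Section hspace.
Variables (C : numClosedFieldType) (n : nat).
Implicit Types (j : 'I_n.+1) (s t : {set 'I_n.+1}) (x y : hspace C n).

Definition Zb s : hspace C n := [ffun t => (t == s)%:R].

Definition hinner x y : C := \sum_s x s * (y s)^*.

Lemma hinner_Zb s t : hinner (Zb s) (Zb t) = (s == t)%:R.
Proof.
rewrite /hinner (bigD1 s)//= big1 ?addr0 => [|i /negPf si]; last first.
  by rewrite ffunE si mul0r.
by rewrite !ffunE eqxx mul1r conjC_nat.
Qed.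

Lemma Zb_span x : x = \sum_s x s *: Zb s.
Proof.
apply/ffunP => t; rewrite sum_ffunE (bigD1 t)//= big1 ?addr0 => [|s /negPf st].
  by rewrite !ffunE eqxx /GRing.scale/= mulr1.
by rewrite !ffunE eq_sym st /GRing.scale/= mulr0.
Qed.

(* The linear operator sending each [Zb s] to [f s]. *)
Definition lin_ext (f : {set 'I_n.+1} -> hspace C n) x : hspace C n :=
  \sum_s x s *: f s.

Lemma lin_ext_linear f : linear (lin_ext f).
Proof.
move=> a x y; rewrite /lin_ext scaler_sumr -big_split/=; apply: eq_bigr => s _.
by rewrite !ffunE scalerDl scalerA.
Qed.
HB.instance Definition _ f := @GRing.isLinear.Build _ _ _ _ (lin_ext f)
  (lin_ext_linear f).

Lemma lin_ext_Zb f s : lin_ext f (Zb s) = f s.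
Proof.
rewrite /lin_ext (bigD1 s)//= big1 ?addr0 => [|t /negPf ts].
  by rewrite ffunE eqxx scale1r.
by rewrite ffunE ts scale0r.
Qed.

Definition annihilation j : {linear hspace C n -> hspace C n} :=
  lin_ext (fun s => (j \in s)%:R *: Zb (s :\ j)%SET).

Definition creation j : {linear hspace C n -> hspace C n} :=
  lin_ext (fun s => (1 - (j \in s)%:R) *: Zb (j |: s)%SET).

Lemma creation_annihilation_linear (p q : C) j :
  linear (fun x => p *: creation j x + q *: annihilation j x).
Proof.
move=> a x y; rewrite (linearP (creation j)) (linearP (annihilation j)).
by rewrite !scalerDr !scalerA addrACA !(mulrC a).
Qed.

Lemma annihilation_Zb j s :
  annihilation j (Zb s) = (j \in s)%:R *: Zb (s :\ j)%SET.
Proof. exact: lin_ext_Zb. Qed.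

Lemma creation_Zb j s :
  creation j (Zb s) = (1 - (j \in s)%:R) *: Zb (j |: s)%SET.
Proof. exact: lin_ext_Zb. Qed.

(* Hence [annihilation j] and [creation j] are mutually adjoint. *)
Lemma hinner_annihilation j s t :
  hinner (annihilation j (Zb s)) (Zb t) = hinner (Zb s) (creation j (Zb t)).
Proof.
have scl a s1 t1 : hinner (a *: Zb s1) (Zb t1) = a * (s1 == t1)%:R.
  rewrite -hinner_Zb /hinner mulr_sumr; apply: eq_bigr => i _.
  by rewrite ffunE /GRing.scale/= mulrA.
have scr b s1 t1 : hinner (Zb s1) ((1 - b%:R) *: Zb t1) = (1 - b%:R) * (s1 == t1)%:R.
  rewrite -hinner_Zb /hinner mulr_sumr; apply: eq_bigr => i _.
  by rewrite [X in _ * X^*]ffunE /GRing.scale/= rmorphM rmorphB rmorph1 rmorph_nat mulrCA.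
rewrite annihilation_Zb creation_Zb scl scr.
have -> : (1 - (j \in t)%:R : C) = (j \notin t)%:R.
  by case: (j \in t); rewrite /= ?subrr ?subr0.
rewrite -!natrM !mulnb; congr ((_ : bool)%:R).
apply/andP/andP => -[].
  move=> js /eqP <-; split; first by rewrite !inE eqxx.
  by rewrite finset.setD1K.
move=> jt /eqP ->; split; first by rewrite !inE eqxx.
by rewrite finset.setU1K.
Qed.

End hspace.

(* As [Zb] is an orthonormal basis of [h_n], the tensor product of [h_n] with [K]
   is the Hilbert sum of copies of [K] indexed by [{set 'I_n.+1}]; the element
   [f] is [\sum_s tens (Zb s) (f s)]. *)
Notation tensor n K := {ffun {set 'I_(n.+1)} -> K}.

Section tensor.
Variables (C : numClosedFieldType) (n : nat) (K : hilbertType C).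
Implicit Types (x y : hspace C n) (u v : K) (f : tensor n K).

Definition tens x u : tensor n K := [ffun s => x s *: u].

Lemma inner_tens x y u v : inner (tens x u) (tens y v) = hinner x y * inner u v.
Proof.
rewrite [LHS](_ : _ = \sum_s inner (tens x u s) (tens y v s))//.
rewrite /hinner mulr_suml; apply: eq_bigr => s _.
by rewrite !ffunE linearZl_LR/= linearZr_LR/= mulrA.
Qed.

Lemma tens_span f : f = \sum_s tens (Zb C s) (f s).
Proof.
apply/ffunP => t; rewrite sum_ffunE (bigD1 t)//= big1 ?addr0 => [|s /negPf st].
  by rewrite !ffunE eqxx scale1r.
by rewrite !ffunE eq_sym st scale0r.
Qed.

Definition tens_op (A : hspace C n -> hspace C n) (B : K -> K) f : tensor n K :=
  \sum_s tens (A (Zb C s)) (B (f s)).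

Lemma tens_opE (A : {linear hspace C n -> hspace C n}) (B : {linear K -> K}) x u :
  tens_op A B (tens x u) = tens (A x) (B u).
Proof.
apply/ffunP => t; rewrite [in RHS](Zb_span x) linear_sum !ffunE/=.
rewrite /tens_op !sum_ffunE scaler_suml; apply: eq_bigr => s _.
by rewrite !ffunE !linearZ/= ffunE; exact: scalerA.
Qed.

Lemma tens_op_linear (A : hspace C n -> hspace C n) (B : {linear K -> K}) :
  linear (tens_op A B).
Proof.
move=> a f g; rewrite /tens_op scaler_sumr -big_split/=; apply: eq_bigr => s _.
by apply/ffunP => t; rewrite !ffunE linearP scalerDr !scalerA mulrC.
Qed.
HB.instance Definition _ A (B : {linear K -> K}) :=
  @GRing.isLinear.Build _ _ _ _ (tens_op A B) (tens_op_linear A B).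

End tensor.

(* Naming the field keeps a single inference path to its algebraic structures. *)
Definition Cplx (R : realType) : numClosedFieldType := R[i].

Section quantum_walk.
Variables (R : realType) (n : nat) (K : hilbertType (Cplx R)).

Definition magnetic_potential (nu : {set 'I_n.+1} -> {set 'I_n.+1} -> R) :=
  (forall s t, - pi <= nu s t <= pi) /\ (forall s t, nu s t = - nu t s).

Definition expi (t : R) : Cplx R := cos t +i* sin t.

Definition Xi (nu : {set 'I_n.+1} -> {set 'I_n.+1} -> R) (j : 'I_n.+1)
    (x : hspace (Cplx R) n) : hspace (Cplx R) n :=
  let nuj := nu [set j]%SET ([set: 'I_n.+1] :\ j)%SET in
  expi (- nuj) *: creation (Cplx R) j x + expi nuj *: annihilation (Cplx R) j x.

Lemma Xi_linear nu j : linear (Xi nu j).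
Proof. exact: creation_annihilation_linear. Qed.
HB.instance Definition _ nu j := @GRing.isLinear.Build _ _ _ _ (Xi nu j)
  (Xi_linear nu j).

Definition quantum_walk (c : 'I_n.+1 -> {linear K -> K})
    (nu : {set 'I_n.+1} -> {set 'I_n.+1} -> R) (f : tensor n K) : tensor n K :=
  \sum_(j < n.+1) tens_op (Xi nu j) (c j) f.

Lemma quantum_walk_linear c nu : linear (quantum_walk c nu).
Proof.
move=> a f g; rewrite /quantum_walk scaler_sumr -big_split/=.
by apply: eq_bigr => j _; exact: tens_op_linear.
Qed.
HB.instance Definition _ c nu := @GRing.isLinear.Build _ _ _ _ (quantum_walk c nu)
  (quantum_walk_linear c nu).

End quantum_walk.

(* Main.v *)
Require Import Defs.
From mathcomp Require Import all_boot all_order all_algebra.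
From mathcomp Require Import complex ring.
From mathcomp Require Import boolp classical_sets reals topology normedtype trigo.
Set Implicit Arguments.
Unset Strict Implicit.
Unset Printing Implicit Defensive.
Import Order.TTheory GRing.Theory Num.Theory.
Local Open Scope ring_scope.

(** The walks of two potentials are conjugate by a diagonal unitary: multiplying
    the component at [s] by the product of the phases [e^(i (nu_j - nu'_j))], [j]
    in [s], turns [W^nu] into [W^nu'], since passing from [s] to [s] with [j]
    added changes that product by exactly the ratio of the two hopping phases.
    Conjugation by a linear isometry preserves (approximate) eigenvectors. *)

Section isometric_intertwining.
Variables (C : numClosedFieldType) (H : hilbertType C).
Variables (T S G : H -> H).
Hypotheses (Glin : linear G) (Giso : forall x, `|G x| = `|x|).
Hypothesis SG : forall x, S (G x) = G (T x).

Let GB (l : C) (x y : H) : G (y - l *: x) = G y - l *: G x.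
Proof. by rewrite addrC -scaleNr Glin scaleNr addrC. Qed.

(** An isometry kills no nonzero vector, so [G] carries eigenvectors of [T] to eigenvectors of [S].
    Surjectivity of [G] is not assumed, hence only an inclusion. *)
Lemma point_spectrum_intertwined : (point_spectrum T `<=` point_spectrum S)%classic.
Proof.
move=> l [x x0 Tx]; exists (G x); first by rewrite -normr_eq0 Giso normr_eq0.
by apply/eqP; rewrite -subr_eq0 SG -GB Tx subrr -normr_eq0 Giso normr0.
Qed.

(** The residual of [G \o x] is the image under [G] of that of [x], so the two sequences of residual
    norms coincide term by term. *)
Lemma approximate_spectrum_intertwined :
  (approximate_spectrum T `<=` approximate_spectrum S)%classic.
Proof.
move=> l [x [x1 xl]]; exists (G \o x); split=> [k|]; first by rewrite /= Giso.
by under eq_fun do rewrite /= SG -GB Giso.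
Qed.

End isometric_intertwining.

Section expi.
Variable R : realType.

Lemma expiD (a b : R) : expi (a + b) = expi a * expi b.
Proof.
rewrite /expi cosD sinD; apply/eqP; rewrite eq_complex /=.
by apply/andP; split; apply/eqP; ring.
Qed.

Lemma norm_expi (a : R) : `|expi a| = 1.
Proof.
(* The modulus in [R[i]] computes to this square root. *)
rewrite [LHS](_ : _ = (Num.sqrt (cos a ^+ 2 + sin a ^+ 2))%:C%C)//.
by rewrite cos2Dsin2 sqrtr1.
Qed.

End expi.

Section ladder.
Variables (C : numClosedFieldType) (n : nat) (j : 'I_n.+1).
Implicit Types s t : {set 'I_n.+1}.

Lemma ladder_ZbE (p q : C) s t :
  (p *: creation C j (Zb C s) + q *: annihilation C j (Zb C s)) t =
  if j \in s then q * (t == s :\ j)%:R else p * (t == j |: s)%:R.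
Proof.
have scaleE (x y : C) : x *: (y : C^o) = x * y by [].
rewrite creation_Zb annihilation_Zb !ffunE !scaleE.
case: (j \in s).
  by rewrite subrr mul0r mulr0 add0r mul1r.
by rewrite subr0 mul1r mul0r mulr0 addr0.
Qed.

(** Creating [j] multiplies [ph] by [r] and annihilating it undoes this; so [r] sits on opposite
    sides of the two coefficient equations, which avoids dividing by it. *)
Lemma ladder_phase (ph : {set 'I_n.+1} -> C) (r p q p' q' : C) s t :
  (forall s, j \notin s -> ph (j |: s)%SET = r * ph s) ->
  p' = r * p -> q = r * q' ->
  (p' *: creation C j (Zb C s) + q' *: annihilation C j (Zb C s)) t * ph s =
  ph t * (p *: creation C j (Zb C s) + q *: annihilation C j (Zb C s)) t.
Proof.
move=> phU1 -> ->; rewrite !ladder_ZbE; case: ifPn => js.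
  have [->|_] := eqVneq t (s :\ j)%SET; last by rewrite !mulr0 mul0r.
  (* Annihilation is creation read backwards: [s] is [j] added to [s :\ j]. *)
  have -> : ph s = r * ph (s :\ j)%SET.
    by rewrite -[in LHS](finset.setD1K js) phU1// setD11.
  by rewrite !mulr1 mulrCA mulrA mulrC.
have [->|_] := eqVneq t (j |: s)%SET; last by rewrite !mulr0 mul0r.
by rewrite !mulr1 phU1// mulrAC.
Qed.

End ladder.

(** The hypothesis is the matrix form of intertwining by the diagonal [ph]; [B] acts on the other
    factor and commutes with scalars. *)
Lemma tens_op_phase (C : numClosedFieldType) (n : nat) (K : hilbertType C)
    (ph : {set 'I_n.+1} -> C) (A A' : hspace C n -> hspace C n)
    (B : {linear K -> K}) (f : tensor n K) t :
  (forall s, A' (Zb C s) t * ph s = ph t * A (Zb C s) t) ->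
  tens_op A' B [ffun s => ph s *: f s] t = ph t *: tens_op A B f t.
Proof.
move=> AA'; rewrite /tens_op !sum_ffunE scaler_sumr; apply: eq_bigr => s _.
by rewrite !ffunE linearZ/= !scalerA AA'.
Qed.

Section gauge.
Variables (R : realType) (n : nat) (K : hilbertType (Cplx R)).
Implicit Types (nu : {set 'I_n.+1} -> {set 'I_n.+1} -> R) (a : 'I_n.+1 -> R).
Implicit Types (s t : {set 'I_n.+1}) (f : tensor n K).

Definition phase a s : Cplx R := expi (\sum_(j in s) a j).

Definition gauge a f : tensor n K := [ffun s => phase a s *: f s].

Lemma phaseU1 a j s : j \notin s -> phase a (j |: s) = expi (a j) * phase a s.
Proof. by move=> js; rewrite /phase big_setU1//= expiD. Qed.

Lemma gauge_linear a : linear (gauge a).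
Proof.
by move=> l f g; apply/ffunP => s; rewrite !ffunE scalerDr !scalerA mulrC.
Qed.

Lemma norm_gauge a f : `|gauge a f| = `|f|.
Proof.
rewrite !ffun_normE; congr sqrtC; apply: eq_bigr => s _.
by rewrite ffunE normrZ norm_expi mul1r.
Qed.

Definition edge_potential nu j : R := nu [set j]%SET ([set: 'I_n.+1] :\ j)%SET.

Lemma Xi_phase nu nu' j s t :
  let a := fun i => edge_potential nu i - edge_potential nu' i in
  Xi nu' j (Zb (Cplx R) s) t * phase a s = phase a t * Xi nu j (Zb (Cplx R) s) t.
Proof.
(* The ratio [r] is [expi (a j)]; the coefficient equations become additive identities between
   angles. *)
move=> a; apply: (@ladder_phase _ _ _ _ (expi (a j))) => [s' /phaseU1->//||];
  rewrite -expiD /a; first by rewrite addrAC subrr add0r.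
by rewrite subrK.
Qed.

(** One gauge serves every [j] at once, so the intertwining passes to the sum. *)
Lemma quantum_walk_gauge (c : 'I_n.+1 -> {linear K -> K}) nu nu' f :
  let a := fun i => edge_potential nu i - edge_potential nu' i in
  quantum_walk c nu' (gauge a f) = gauge a (quantum_walk c nu f).
Proof.
move=> a; apply/ffunP => t; rewrite /quantum_walk !ffunE !sum_ffunE scaler_sumr.
by apply: eq_bigr => j _; apply: tens_op_phase => s; exact: Xi_phase.
Qed.

End gauge.

Theorem theorem4p7 (R : realType) (n : nat) (K : hilbertType (Cplx R))
    (sepK : separable K) (dimK : dim_ge K n.+1)
    (c : 'I_n.+1 -> {linear K -> K}) (hc : coin_system c)
    (nu nu' : {set 'I_n.+1} -> {set 'I_n.+1} -> R)
    (hnu : magnetic_potential nu) (hnu' : magnetic_potential nu') :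
  point_spectrum (quantum_walk c nu) = point_spectrum (quantum_walk c nu') /\
  approximate_spectrum (quantum_walk c nu) =
    approximate_spectrum (quantum_walk c nu').
Proof.
(* Left general in both potentials: swapping them gives the reverse inclusions. *)
have GW mu mu' := @quantum_walk_gauge R n K c mu mu'.
split; apply/seteqP; split.
- exact: point_spectrum_intertwined (gauge_linear _) (norm_gauge _) (GW nu nu').
- exact: point_spectrum_intertwined (gauge_linear _) (norm_gauge _) (GW nu' nu).
- exact: approximate_spectrum_intertwined (gauge_linear _) (norm_gauge _) (GW _ _).
- exact: approximate_spectrum_intertwined (gauge_linear _) (norm_gauge _) (GW _ _).
Qed.
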